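(* Let $k$ be a field of characteristic zero and let $\mathfrak{m}_0$ be the Lie algebra over $k$ with basis $e_i$, $i\geq 1$, whose only nonzero brackets (up to skew-symmetry) are $[e_1,e_i]=e_{i+1}$ for $i\geq 2$. Then for each weight $l\in\mathbb{Z}$, $$\dim H^2_l(\mathfrak{m}_0,\mathfrak{m}_0)=\infty .$$
   Context: For $l\in\mathbb{Z}$, $C^q_l(\mathfrak{m}_0,\mathfrak{m}_0)$ is the space of alternating $q$-linear maps $\mathfrak{m}_0^q\to\mathfrak{m}_0$ that are homogeneous of weight $l$, i.e. send $(e_{i_1},\dots,e_{i_q})$ to a scalar multiple of $e_{i_1+\dots+i_q+l}$ (zero if this index is $\le 0$). $H^2_l(\mathfrak{m}_0,\mathfrak{m}_0)$ is the second cohomology of the complex $C^*_l(\mathfrak{m}_0,\mathfrak{m}_0)$ with the Chevalley–Eilenberg differential for adjoint coefficients. *)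

(* Defs.v *)
From HB Require Import structures.
From mathcomp Require Import all_boot all_order all_algebra ring.

Set Implicit Arguments.
Unset Strict Implicit.
Unset Printing Implicit Defensive.

Import GRing.Theory.
Local Open Scope ring_scope.

HB.mixin Record isLieAlgebra (k : fieldType) L of GRing.Lmodule k L := {
  lie_br : L -> L -> L;
  lie_br_linear_l : forall (a : k) (x y z : L),
    lie_br (a *: x + y) z = a *: lie_br x z + lie_br y z;
  lie_br_linear_r : forall (a : k) (x y z : L),
    lie_br x (a *: y + z) = a *: lie_br x y + lie_br x z;
  lie_brxx : forall x : L, lie_br x x = 0;
  lie_jacobi : forall x y z : L,
    lie_br x (lie_br y z) + lie_br y (lie_br z x) + lie_br z (lie_br x y) = 0
}.

#[short(type="lieAlgType")]
HB.structure Definition LieAlgebra (k : fieldType) :=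
  { L of GRing.Lmodule k L & isLieAlgebra k L }.

Section ChevalleyEilenberg.
Variables (k : fieldType) (L : lieAlgType k).

Definition multimap (q : nat) := {ffun 'I_q -> L} -> L.

Definition upd q (x : {ffun 'I_q -> L}) (i : 'I_q) (u : L) : {ffun 'I_q -> L} :=
  [ffun j => if j == i then u else x j].

Definition multilinear q (c : multimap q) : Prop :=
  forall (x : {ffun 'I_q -> L}) (i : 'I_q) (a : k) (u v : L),
    c (upd x i (a *: u + v)) = a *: c (upd x i u) + c (upd x i v).

Definition alternating q (c : multimap q) : Prop :=
  forall (x : {ffun 'I_q -> L}) (i j : 'I_q), i != j -> x i = x j -> c x = 0.

Definition omit1 q (x : {ffun 'I_q.+1 -> L}) (i : 'I_q.+1) : {ffun 'I_q -> L} :=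
  [ffun a => x (lift i a)].

(* For i < j, the tuple ([x_i, x_j], x_0, .., ^x_i, .., ^x_j, .., x_q): the
   a-th remaining entry has index bump j (bump i a). *)
Definition bracket_omit2 q (x : {ffun 'I_q.+1 -> L}) (i j : 'I_q.+1) :
    {ffun 'I_q -> L} :=
  [ffun a : 'I_q => if val a is b.+1 then x (inord (bump j (bump i b)))
                    else lie_br (x i) (x j)].

(* The Chevalley-Eilenberg differential with adjoint coefficients. *)
Definition CEd q (c : multimap q) : multimap q.+1 := fun x =>
  \sum_(i < q.+1) (-1) ^+ i *: lie_br (x i) (c (omit1 x i))
  + \sum_(i < q.+1) \sum_(j < q.+1 | (i < j)%N)
      (-1) ^+ (i + j) *: c (bracket_omit2 x i j).

End ChevalleyEilenberg.

(* The underlying vector space of m_0: finitely supported sequences, with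
   'X^n standing for e_(n+1); the ring structure of {poly k} plays no role. *)
Definition m0 (k : fieldType) : Type := {poly k}.

HB.instance Definition _ (k : fieldType) := GRing.Lmodule.on (m0 k).

(* e_m for every integer m, with e_m = 0 when m <= 0. *)
Definition e (k : fieldType) (m : int) : m0 k :=
  if m is Posz n.+1 then ('X^n : {poly k}) else 0.

Definition m0_br_basis (k : fieldType) (i j : nat) : m0 k :=
  if (i == 1%N) && (2 <= j)%N then e k j.+1
  else if (j == 1%N) && (2 <= i)%N then - e k i.+1
  else 0.

Definition m0_br (k : fieldType) (x y : m0 k) : m0 k :=
  \sum_(i < size (x : {poly k})) \sum_(j < size (y : {poly k}))
    ((x : {poly k})`_i * (y : {poly k})`_j) *: m0_br_basis k i.+1 j.+1.

Lemma m0_brE (k : fieldType) (x y : {poly k}) :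
  m0_br x y = (x`_0 *: y - y`_0 *: x) * 'X :> {poly k}.
Proof.
pose d (i : nat) : k := (i == 0)%:R.
have base i j : m0_br_basis k i.+1 j.+1 =
    (d i *: 'X^j - d j *: 'X^i) * 'X :> {poly k}.
  rewrite /m0_br_basis /d !eqSS !ltnS.
  case: i j => [|i] [|j] //=.
  - by rewrite subrr mul0r.
  - by rewrite scale1r scale0r subr0 -exprSr.
  - by rewrite scale1r scale0r sub0r mulNr -exprSr.
  - by rewrite !scale0r subrr mul0r.
have polyE (p : {poly k}) : \sum_(i < size p) p`_i *: 'X^i = p.
  by rewrite -poly_def coefK.
have coef0E (p : {poly k}) : \sum_(i < size p) p`_i * d i = p`_0.
  rewrite -[in RHS](polyE p) coef_sum; apply: eq_bigr => i _.
  by rewrite coefZ coefXn eq_sym.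
transitivity ((\sum_(i < size x) \sum_(j < size y)
   ((x`_i * d i) *: (y`_j *: 'X^j) - (y`_j * d j) *: (x`_i *: 'X^i)) * 'X)
   : {poly k}).
  apply: eq_bigr => i _; apply: eq_bigr => j _.
  rewrite base -!mul_polyC !polyCM; ring.
rewrite -[in RHS](coef0E x) -[in RHS](coef0E y).
under eq_bigr => i _ do
  rewrite -mulr_suml sumrB -scaler_sumr polyE -scaler_suml coef0E.
by rewrite -mulr_suml sumrB -scaler_suml -scaler_sumr polyE !coef0E.
Qed.

Section M0Lie.
Variable k : fieldType.
Implicit Types (a : k) (x y z : m0 k).

Fact m0_br_linear_l a x y z :
  m0_br (a *: x + y) z = a *: m0_br x z + m0_br y z.
Proof.
rewrite !m0_brE coefD coefZ -!mul_polyC !polyCD !polyCM; ring.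
Qed.

Fact m0_br_linear_r a x y z :
  m0_br x (a *: y + z) = a *: m0_br x y + m0_br x z.
Proof.
rewrite !m0_brE coefD coefZ -!mul_polyC !polyCD !polyCM; ring.
Qed.

Fact m0_brxx x : m0_br x x = 0.
Proof. by rewrite m0_brE subrr mul0r. Qed.

Fact m0_jacobi x y z :
  m0_br x (m0_br y z) + m0_br y (m0_br z x) + m0_br z (m0_br x y) = 0.
Proof.
rewrite !m0_brE !coefMX /= -!mul_polyC !polyC0; ring.
Qed.

HB.instance Definition _ := isLieAlgebra.Build k (m0 k)
  m0_br_linear_l m0_br_linear_r m0_brxx m0_jacobi.

End M0Lie.

Section WeightCohomology.
Variable k : fieldType.

Definition homogeneous (q : nat) (l : int) (c : multimap (m0 k) q) : Prop :=
  forall n : 'I_q -> nat, (forall i, 0 < n i)%N ->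
    exists a : k,
      c [ffun i => e k (n i)] = a *: e k (\sum_(i < q) (n i)%:Z + l).

Definition cochain (q : nat) (l : int) (c : multimap (m0 k) q) : Prop :=
  [/\ multilinear c, alternating c & homogeneous l c].

Definition cocycle (q : nat) (l : int) (c : multimap (m0 k) q) : Prop :=
  cochain l c /\ (forall x, CEd c x = 0).

Definition coboundary (q : nat) (l : int) : multimap (m0 k) q -> Prop :=
  match q with
  | 0 => fun c => forall x, c x = 0
  | p.+1 => fun c => exists2 b : multimap (m0 k) p,
      cochain l b & forall x, c x = CEd b x
  end.

(* The classes of the cocycles z_0, .., z_(n-1) in H^q_l are linearly
   independent. *)
Definition independent_classes (q : nat) (l : int) (n : nat)
    (z : 'I_n -> multimap (m0 k) q) : Prop :=
  forall a : 'I_n -> k,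
    coboundary l (fun x => \sum_(i < n) a i *: z i x) -> forall i, a i = 0.

Definition dim_H_ge (q : nat) (l : int) (n : nat) : Prop :=
  exists z : 'I_n -> multimap (m0 k) q,
    (forall i, cocycle l (z i)) /\ independent_classes l z.

Definition dim_H_infinite (q : nat) (l : int) : Prop :=
  forall n : nat, dim_H_ge q l n.

End WeightCohomology.

(* Main.v *)
Require Import Defs.
From mathcomp Require Import all_boot all_order all_algebra.
From mathcomp Require Import ring zify.
Local Open Scope ring_scope.

Set Implicit Arguments.
Unset Strict Implicit.
Unset Printing Implicit Defensive.

Import GRing.Theory.

(** Identify [e_(i+1)] with [X^i], so that [ad e_1] acts on the ideal
    [J = <e_2, e_3, ..>] as multiplication by [X].  An alternating map
    [J x J -> J] commuting with [ad e_1], extended by 0 on [e_1], is a cocycle.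
    Such maps arise by sending [(x, y)] to a coefficient of [t^r] in the
    antisymmetrization of [x(t) y(z - t)], because [t + (z - t) = z].
    For [r = 2s + 1] the value on [(X^i, X^(i+1))] vanishes for [i < s] and is
    [+-2] times a monomial for [i = s], whereas a coboundary of weight [l]
    vanishes on all these pairs with [i] large: this triangularity makes the
    classes independent. *)

(** * Alternating forms on polynomials, equivariant under multiplication by [X] *)

Section ShiftEquivariantForms.
Variable k : fieldType.
Implicit Types (f g x y : {poly k}) (r m i j : nat).

(** In [{poly {poly k}}] the outer ['X] is [t] and ['X%:P] is [z], so [x^:P] is x(t) and [refl x] is
    x(z - t). *)
Definition refl x : {poly {poly k}} := x^:P \Po ('X%:P - 'X).

Definition antisym x y : {poly {poly k}} := x^:P * refl y - refl x * y^:P.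

Lemma lift_linear (a : k) f g : (a *: f + g)^:P = a%:P%:P * f^:P + g^:P.
Proof. by rewrite rmorphD -mul_polyC rmorphM /= map_polyC. Qed.

Lemma refl_linear (a : k) f g : refl (a *: f + g) = a%:P%:P * refl f + refl g.
Proof. by rewrite /refl lift_linear rmorphD rmorphM /= comp_polyC. Qed.

Lemma liftMX f : (f * 'X)^:P = f^:P * 'X.
Proof. by rewrite rmorphM /= map_polyX. Qed.

Lemma reflMX f : refl (f * 'X) = refl f * ('X%:P - 'X).
Proof. by rewrite /refl liftMX rmorphM /= comp_polyX. Qed.

Lemma liftXn i : ('X^i : {poly k})^:P = 'X^i.
Proof. by rewrite rmorphXn /= map_polyX. Qed.

Lemma reflXn i : refl 'X^i = ('X%:P - 'X) ^+ i.
Proof. by rewrite /refl liftXn rmorphXn /= comp_polyX. Qed.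

Lemma antisymC x y : antisym x y = - antisym y x.
Proof. by rewrite /antisym; ring. Qed.

Lemma antisym_linear (a : k) f g y :
  antisym (a *: f + g) y = a%:P%:P * antisym f y + antisym g y.
Proof. by rewrite /antisym lift_linear refl_linear; ring. Qed.

(* The variables [t] and [z - t] of the two factors add up to [z]. *)
Lemma antisym_equiv x y :
  antisym (x * 'X) y + antisym x (y * 'X) = antisym x y * 'X%:P.
Proof. by rewrite /antisym !reflMX !liftMX; ring. Qed.

(** The coefficient of [t^r] is a polynomial in [z], on which [z] acts as [ad e_1]; the factor
    ['X^m] adjusts the weight without disturbing equivariance. *)
Definition shift_form m r x y : {poly k} := 'X^m * (antisym x y)`_r.

Lemma shift_formC m r x y : shift_form m r x y = - shift_form m r y x.
Proof. by rewrite /shift_form antisymC coefN mulrN. Qed.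

Lemma shift_formxx m r x : shift_form m r x x = 0.
Proof. by rewrite /shift_form /antisym [refl x * _]mulrC subrr coef0 mulr0. Qed.

Lemma shift_form_linear m r (a : k) f g y :
  shift_form m r (a *: f + g) y = a *: shift_form m r f y + shift_form m r g y.
Proof.
by rewrite /shift_form antisym_linear coefD coefCM mul_polyC mulrDr scalerAr.
Qed.

Lemma shift_form0 m r y : shift_form m r 0 y = 0.
Proof.
by rewrite /shift_form /antisym /refl map_poly0 comp_poly0 !mul0r subrr coef0 mulr0.
Qed.

Lemma shift_form_linear_r m r (a : k) f g y :
  shift_form m r y (a *: f + g) = a *: shift_form m r y f + shift_form m r y g.
Proof.
by rewrite shift_formC shift_form_linear opprD -scalerN -!(shift_formC m r y).
Qed.

Lemma shift_form_equiv m r x y :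
  shift_form m r (x * 'X) y + shift_form m r x (y * 'X)
  = shift_form m r x y * 'X.
Proof. by rewrite /shift_form -mulrDr -coefD antisym_equiv coefMC mulrA. Qed.

Lemma shift_form_coef0 m r x y : (shift_form m.+1 r x y)`_0 = 0.
Proof. by rewrite /shift_form coefXnM. Qed.

(* [p : k[z][t]] is homogeneous of total degree [d]. *)
Definition homog (d : nat) (p : {poly {poly k}}) : Prop :=
  forall q : nat, exists a : k, p`_q * 'X^q = a *: 'X^d.

Lemma homogMX d p : homog d p -> homog d.+1 (p * 'X).
Proof.
move=> hp [|q]; first by exists 0; rewrite coefMX /= mul0r scale0r.
by have [a ha] := hp q; exists a; rewrite coefMX /= exprSr mulrA ha exprSr scalerAl.
Qed.

Lemma homogMz d p : homog d p -> homog d.+1 (p * 'X%:P).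
Proof.
move=> hp q; have [a ha] := hp q; exists a.
by rewrite coefMC mulrAC ha exprSr scalerAl.
Qed.

Lemma homogB d p p' : homog d p -> homog d p' -> homog d (p - p').
Proof.
move=> hp hp' q; have [a ha] := hp q; have [b hb] := hp' q.
by exists (a - b); rewrite coefB mulrBl ha hb scalerBl.
Qed.

Lemma homog_monomial i j : homog (i + j) ('X^i * ('X%:P - 'X) ^+ j).
Proof.
elim: j => [|j IHj].
  elim: i => [|i IHi]; last by rewrite exprSr mulrAC; apply: homogMX.
  move=> q; exists (q == 0%N)%:R.
  by rewrite mulr1 coef1; case: q => [|q]; rewrite ?mulr1 ?scale1r // mul0r scale0r.
rewrite addnS exprSr mulrA mulrBr.
by apply: homogB; [apply: homogMz | apply: homogMX].
Qed.

Lemma antisymXn i j : antisym 'X^i 'X^j =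
  'X^i * ('X%:P - 'X) ^+ j - 'X^j * ('X%:P - 'X) ^+ i.
Proof. by rewrite /antisym !liftXn !reflXn [X in _ - X]mulrC. Qed.

(** The form has degree [m + i + j - r] in [z] by homogeneity; multiplying by ['X^r] states this
    without a truncated subtraction. *)
Lemma shift_formXn m r i j : exists a : k,
  shift_form m r 'X^i 'X^j * 'X^r = a *: 'X^(m + (i + j)).
Proof.
have /(_ r)[a ha] : homog (i + j) (antisym 'X^i 'X^j).
  rewrite antisymXn; apply: homogB; first exact: homog_monomial.
  by rewrite addnC; apply: homog_monomial.
by exists a; rewrite /shift_form -mulrA ha -scalerAr -exprD.
Qed.

Lemma shift_formXn_e (l : int) m r i j : m%:Z = r%:Z + 1 + l ->
  exists a : k,
    shift_form m r 'X^i 'X^j = a *: e k (i.+1%:Z + j.+1%:Z + l) :> {poly k}.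
Proof.
move=> hm; have [a ha] := shift_formXn m r i j.
have [le_r|lt_r] := leqP r (m + (i + j)).
  exists a; have -> : i.+1%:Z + j.+1%:Z + l = (m + (i + j) - r).+1%:Z by lia.
  apply: (mulIf (monic_neq0 (monicXn k r))); rewrite ha /= -scalerAl -exprD.
  by rewrite subnK.
(* Here ['X^r] would have to divide a multiple of a lower power of [X], which forces that multiple
   to be zero. *)
exists 0; rewrite scale0r; apply: (mulIf (monic_neq0 (monicXn k r))).
rewrite mul0r; suff a0 : a = 0 by rewrite ha a0 scale0r.
have := congr1 (fun p : {poly k} => p`_(m + (i + j))) ha.
by rewrite coefMXn lt_r coefZ coefXn eqxx mulr1.
Qed.

(** Up to the sign [(-1)^j] this is the power [(t - z)^j], monic of degree [j] in [t]. *)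
Lemma coef_refl_exp j q : (j <= q)%N ->
  (('X%:P - 'X : {poly {poly k}}) ^+ j)`_q = ((q == j)%:R : {poly k}) * (-1) ^+ j.
Proof.
move=> le_jq; rewrite -opprB (exprNn ('X - 'X%:P)).
have -> : (-1) ^+ j = ((-1) ^+ j)%:P :> {poly {poly k}}.
  by rewrite rmorphXn rmorphN1.
rewrite coefCM mulrC.
congr (_ * _); have [->|ne_qj] := eqVneq q j.
  have := monic_exp j (monicXsubC ('X : {poly k})).
  by rewrite monicE lead_coefE size_exp_XsubC => /eqP.
by rewrite nth_default // size_exp_XsubC ltn_neqAle eq_sym ne_qj.
Qed.

(** The antisymmetrization equals [t^i (z - t)^i (z - 2t)], whose degree in [t] is at most [2i + 1],
    with coefficient [-2 (-1)^i] there. *)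
Lemma shift_form_consecutive m s i : (i <= s)%N ->
  shift_form m s.*2.+1 'X^i 'X^(i.+1)
  = (i == s)%:R * ((-1) ^+ s * - 2) *: 'X^m :> {poly k}.
Proof.
move=> le_is; rewrite /shift_form antisymXn.
have -> : 'X^i * ('X%:P - 'X) ^+ i.+1 - 'X^(i.+1) * ('X%:P - 'X) ^+ i =
    'X^i * (('X%:P - 'X) ^+ i * 'X%:P - (('X%:P - 'X) ^+ i * 'X) * 2%:R)
    :> {poly {poly k}}.
  by rewrite exprSr [in X in _ - X]exprSr; ring.
rewrite coefXnM ifN; last by lia.
rewrite coefB coefMC mulr_natr coefMn coefMX ifN; last by lia.
rewrite !coef_refl_exp; try lia.
(* The summand with factor [z] has degree at most [2i < 2s + 1] in [t]; the other reaches [2s + 1]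
   only if [i = s]. *)
have -> : (s.*2.+1 - i == i)%N = false by apply/eqP; lia.
have -> : ((s.*2.+1 - i).-1 == i)%N = (i == s) by apply/eqP/eqP; lia.
rewrite mul0r mul0r sub0r.
have [->|_] := eqVneq i s; last by rewrite !mul0r mul0rn oppr0 mulr0 scale0r.
rewrite !mul1r mulrC -[in RHS]mul_polyC; congr (_ * _).
rewrite polyCM rmorphXn !rmorphN1 polyCN mulrN.
by rewrite (rmorph_nat (@polyC k)) mulr_natr.
Qed.

End ShiftEquivariantForms.

(** * Explicit differentials of 1- and 2-cochains *)

Section LowDegreeDifferential.
Variables (k : fieldType) (L : lieAlgType k).

Lemma eq_CEd q (c c' : multimap L q) x :
  (forall y, c y = c' y) -> CEd c x = CEd c' x.
Proof.
by move=> eq_c; rewrite /CEd; congr (_ + _); apply: eq_bigr => i _;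
  [rewrite eq_c | apply: eq_bigr => j _; rewrite eq_c].
Qed.

Lemma CEd1E (b : L -> L) (x : {ffun 'I_2 -> L}) :
  let x0 := x ord0 in let x1 := x (lift ord0 ord0) in
  CEd (fun y : {ffun 'I_1 -> L} => b (y ord0)) x
  = lie_br x0 (b x1) - lie_br x1 (b x0) - b (lie_br x0 x1).
Proof.
move=> x0 x1; rewrite /CEd.
under [X in _ + X]eq_bigr do rewrite big_mkcond !big_ord_recl big_ord0.
rewrite !big_ord_recl !big_ord0 /= !ffunE /=.
have -> : lift (lift ord0 ord0) ord0 = ord0 :> 'I_2 by apply: val_inj.
rewrite -[bump 0 0]/1%N add0n expr0 expr1 !scale1r !scaleN1r.
by rewrite !add0r !addr0.
Qed.


Lemma CEd2E (c : L -> L -> L) (x : {ffun 'I_3 -> L}) :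
  let x0 := x ord0 in let x1 := x (lift ord0 ord0) in
  let x2 := x (lift ord0 (lift ord0 ord0)) in
  CEd (fun y : {ffun 'I_2 -> L} => c (y ord0) (y (lift ord0 ord0))) x
  = lie_br x0 (c x1 x2) - lie_br x1 (c x0 x2) + lie_br x2 (c x0 x1)
    - c (lie_br x0 x1) x2 + c (lie_br x0 x2) x1 - c (lie_br x1 x2) x0.
Proof.
move=> x0 x1 x2; rewrite /CEd.
have xE i : x i = nth 0 [:: x0; x1; x2] i.
  by case: i => -[|[|[|//]]] lt_i /=; congr (x _); apply: val_inj.
under [X in _ + X]eq_bigr do rewrite big_mkcond !big_ord_recl big_ord0.
rewrite !big_ord_recl !big_ord0 /= !ffunE /= !xE /= !inordK //=.
rewrite -[bump 0 (bump 0 0)]/2%N -[bump 0 0]/1%N !add0n -[(1 + 2)%N]/3%N.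
rewrite expr0 expr1 sqrrN expr1n exprS sqrrN expr1n mulr1 !scale1r !scaleN1r.
by rewrite !add0r !addr0 !addrA.
Qed.
End LowDegreeDifferential.

(** * Extension of the forms to cocycles of weight [l] *)

Section Cocycles.
Variables (k : fieldType) (l : int) (m r : nat).
Hypothesis m_eq : m.+1%:Z = r%:Z + 1 + l.

(** The projection onto [J] along [e_1], since the constant coefficient is the [e_1]-coordinate. *)
Definition hat (x : {poly k}) : {poly k} := x - (x`_0)%:P.

Lemma hat_linear (a : k) (x y : {poly k}) :
  hat (a *: x + y) = a *: hat x + hat y.
Proof.
rewrite /hat coefD coefZ polyCD polyCM -!mul_polyC; ring.
Qed.

Lemma hat1 : hat 1 = 0.
Proof. by rewrite /hat coef1 subrr. Qed.

Lemma hatXn (i : nat) : (0 < i)%N -> hat 'X^i = 'X^i.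
Proof. by case: i => // i _; rewrite /hat coefXn subr0. Qed.

Lemma br_hat (x y : {poly k}) :
  m0_br x y = (x`_0 *: hat y - y`_0 *: hat x) * 'X :> {poly k}.
Proof. by rewrite m0_brE /hat -!mul_polyC; ring. Qed.

Lemma hat_br (x y : {poly k}) :
  hat (m0_br x y) = x`_0 *: (hat y * 'X) - y`_0 *: (hat x * 'X).
Proof.
by rewrite br_hat {1}/hat coefMX /= polyC0 subr0 mulrBl -!scalerAl.
Qed.

(** The exponent [m.+1] is positive so that all values lie in [J]. *)
Definition shift_cochain : multimap (m0 k) 2 := fun x =>
  shift_form m.+1 r (hat (x ord0)) (hat (x (lift ord0 ord0))).

Lemma shift_cochain_cochain : cochain l shift_cochain.
Proof.
split.
- move=> x i a u v; rewrite /shift_cochain !ffunE.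
  case: (unliftP ord0 i) => [j|] ->.
    by rewrite (ord1 j) /= hat_linear shift_form_linear_r.
  by rewrite /= hat_linear shift_form_linear.
- move=> x i j ne_ij eq_x.
  suff eq_x01 : x ord0 = x (lift ord0 ord0).
    by rewrite /shift_cochain eq_x01 shift_formxx.
  move: ne_ij eq_x; case: (unliftP ord0 i) => [i'|] ->;
    case: (unliftP ord0 j) => [j'|] -> //; rewrite ?(ord1 i') ?(ord1 j') //.
- move=> n n_gt0; rewrite /shift_cochain !ffunE big_ord_recl big_ord1.
  have := n_gt0 ord0; have := n_gt0 (lift ord0 ord0).
  case: (n (lift ord0 ord0)) => // j _; case: (n ord0) => // i _.
  (* An exponent 0 means that the argument is [e_1], which [hat] kills. *)
  case: i => [|i]; first by exists 0; rewrite hat1 shift_form0 scale0r.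
  case: j => [|j].
    by exists 0; rewrite hat1 shift_formC shift_form0 oppr0 scale0r.
  by rewrite !hatXn //; apply: shift_formXn_e m_eq.
Qed.

Lemma shift_cochain_cocycle : cocycle l shift_cochain.
Proof.
split; first exact: shift_cochain_cochain.
move=> x.
rewrite (CEd2E (fun u v : m0 k => shift_form m.+1 r (hat u) (hat v))).
set x0 := x ord0; set x1 := x (lift ord0 ord0).
set x2 := x (lift ord0 (lift ord0 ord0)).
(* As the form takes values in [J], only the [e_1]-coordinate of [u] acts, through multiplication by
   [X], which equivariance distributes over both arguments. *)
have brE (u v w : {poly k}) :
    lie_br (u : m0 k) (shift_form m.+1 r v w : m0 k)
    = u`_0 *: (shift_form m.+1 r (v * 'X) w + shift_form m.+1 r v (w * 'X))
    :> {poly k}.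
  rewrite [LHS]m0_brE shift_form_coef0 scale0r subr0 shift_form_equiv.
  by rewrite -scalerAl.
have hat_brE (u v w : {poly k}) :
    shift_form m.+1 r (hat (lie_br (u : m0 k) (v : m0 k))) w
    = u`_0 *: shift_form m.+1 r (hat v * 'X) w
      - v`_0 *: shift_form m.+1 r (hat u * 'X) w.
  by rewrite [lie_br _ _]/(m0_br _ _) hat_br -scaleNr addrC shift_form_linear
             -[_ *: (hat v * 'X)]addr0 shift_form_linear shift_form0 addr0
             scaleNr addrC.
rewrite !brE !hat_brE.
(* Skew-symmetry moves each factor [X] to the first argument, so that equal terms match and
   cancel. *)
rewrite !(shift_formC _ _ (hat x0) (_ * 'X)) !(shift_formC _ _ (hat x1) (_ * 'X)).
rewrite -!mul_polyC; ring.
Qed.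

End Cocycles.

(** * Vanishing of coboundaries on consecutive basis vectors, and independence *)

Section Coboundaries.
Variables (k : fieldType) (l : int).

(** Both arguments lie in the abelian ideal [J], and the bound on [i] puts their images under [b] in
    [J] too, so every bracket vanishes. *)
Lemma CEd_consecutive (b : multimap (m0 k) 1) (i : nat) :
  cochain l b -> (0 < i)%N -> (0 < i%:Z + l) ->
  CEd b [ffun j : 'I_2 => ('X^(i + j) : {poly k}) : m0 k] = 0.
Proof.
case=> lin_b _ hom_b i_gt0 il_gt0.
pose B (u : m0 k) : m0 k := b [ffun=> u].
rewrite (@eq_CEd _ _ _ _ (fun y : {ffun 'I_1 -> m0 k} => B (y ord0))); last first.
  by move=> y; congr (b _); apply/ffunP => j; rewrite ffunE (ord1 j).
rewrite CEd1E !ffunE.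
have B0 : B 0 = 0.
  have := lin_b [ffun=> 0] ord0 1 0 0; rewrite !scale1r addr0.
  have -> : upd [ffun=> 0] ord0 0 = [ffun=> 0] :> {ffun 'I_1 -> m0 k}.
    by apply/ffunP => j; rewrite !ffunE; case: eqP.
  by move/eqP; rewrite -subr_eq subrr eq_sym => /eqP.
have B_coef0 j : (i <= j)%N -> (B ('X^j : {poly k}) : {poly k})`_0 = 0.
  move=> le_ij; have [//|a] := hom_b (fun=> j.+1).
  rewrite big_ord1 /= => B_eq; rewrite [B _]B_eq.
  (* The target index [j + 1 + l] is at least 2, hence the value has no [e_1]-component. *)
  have -> : j.+1%:Z + l = `|j%:Z + l|.-1.+2%:Z by lia.
  by rewrite coefZ coefXn mulr0.
have br0 (u v : {poly k}) : u`_0 = 0 -> v`_0 = 0 -> lie_br (u : m0 k) v = 0.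
  by move=> u0 v0; rewrite [LHS]m0_brE u0 v0 !scale0r subrr mul0r.
have X0 j : (i <= j)%N -> ('X^j : {poly k})`_0 = 0.
  by rewrite coefXn => le_ij; rewrite (_ : (0 == j)%N = false) //; apply/eqP; lia.
rewrite /= -[bump 0 0]/1%N addn0 addn1.
by rewrite !br0 ?B0 ?subrr ?X0 ?B_coef0.
Qed.

Lemma independent_shift_cochains (n : nat) (m r : 'I_n -> nat) (N : nat) :
    (2%:R != 0 :> k) -> (0 < N%:Z + l) -> (0 < N)%N ->
    (forall j, r j = (N + j).*2.+1) ->
  independent_classes l (fun j => @shift_cochain k (m j) (r j)).
Proof.
move=> nz2 Nl_gt0 N_gt0 rE a [b b_cochain eq_b] j.
(* Strong induction on [j], evaluating at [X^(N+j)] and [X^(N+j+1)]: terms with [i < j] have zero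
   coefficient by induction, those with [i > j] vanish there as [N + j < N + i]. *)
have [s] := ubnP (val j); elim: s j => // s IHs j le_js.
have := eq_b [ffun q : 'I_2 => ('X^(N + j + q) : {poly k}) : m0 k].
rewrite CEd_consecutive //; try lia.
rewrite (bigD1 j) //= big1 => [|i ne_ij]; last first.
  have [lt_ij|ge_ij] := ltnP i j.
    by rewrite IHs ?scale0r //; apply: leq_trans lt_ij _.
  rewrite /shift_cochain !ffunE -[nat_of_ord (lift _ _)]/1%N addn0 addn1.
  rewrite !hatXn; try lia.
  rewrite rE shift_form_consecutive; last by lia.
  rewrite (_ : (_ == _)%N = false) ?mul0r ?scale0r ?scaler0 //.
  by apply: contra_neqF ne_ij => /eqP eq_ij; apply: ord_inj; lia.
rewrite addr0 /shift_cochain !ffunE -[nat_of_ord (lift _ _)]/1%N addn0 addn1.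
rewrite !hatXn; try lia.
rewrite rE shift_form_consecutive // eqxx mul1r => /eqP.
rewrite scalerA -mul_polyC mulf_eq0 (negPf (monic_neq0 (monicXn k _))) orbF.
by rewrite polyC_eq0 !mulf_eq0 signr_eq0 oppr_eq0 (negPf nz2) !orbF => /eqP.
Qed.

End Coboundaries.

Theorem theorem4 (k : fieldType) (char0 : [pchar k] =i pred0) (l : int) :
  dim_H_infinite k 2 l.
Proof.
(* This choice gives [N + l > 0] and [r j > |l|], so [absz] leaves [r j + l] unchanged and the
   weight condition [m + 1 = r + 1 + l] holds. *)
move=> n; pose N := (absz l).+1.
pose r (j : 'I_n) := (N + j).*2.+1; pose m (j : 'I_n) := absz ((r j)%:Z + l).
exists (fun j => @shift_cochain k (m j) (r j)); split.
  by move=> j; apply: shift_cochain_cocycle; rewrite /m /r /N; lia.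
apply: (independent_shift_cochains (N := N)) => //; rewrite ?/N; try lia.
by rewrite ((pcharf0P k).1 char0).
Qed.
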